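(* Let $\mathbf{A}$ be a complex $m\times n$ matrix of rank $k$. Let $\mathbf{F}$ be an $m\times k$ matrix whose columns form a basis of the column space $\mathcal{C}(\mathbf{A})$, and let $\mathbf{H}$ be an $n\times k$ matrix whose columns form a basis of the row space $\mathcal{C}(\mathbf{A}^* )$. Let $\mathbf{Y}$ be an $m\times k$ matrix and $\mathbf{X}$ an $n\times k$ matrix satisfying $$\mathbf{Y}^*\mathbf{F}=\mathbf{H}^*\mathbf{X}=\mathbf{I}_k .$$ Then $$\mathbf{A}=\mathbf{F}\mathbf{Y}^*\mathbf{A}\mathbf{X}\mathbf{H}^* .$$
   Context: $\mathbf{W}^*$ denotes the conjugate transpose of a matrix $\mathbf{W}$, $\mathbf{I}_k$ is the $k\times k$ identity matrix, $\mathcal{C}(\mathbf{A})$ denotes the column space of $\mathbf{A}$, and $\mathcal{C}(\mathbf{A}^* )$ (the column space of $\mathbf{A}^*$) is called the row space of $\mathbf{A}$. *)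

(* Defs.v *)
From mathcomp Require Import all_boot all_order all_algebra.

Set Implicit Arguments.
Unset Strict Implicit.
Unset Printing Implicit Defensive.

Local Open Scope ring_scope.

Definition cols (K : fieldType) (m n : nat) (A : 'M[K]_(m, n)) :
  n.-tuple 'cV[K]_m := [tuple col j A | j < n].

(* MathComp's matrix-space operations ( _ <= _ )%MS etc. act on row spaces,
   so the column space is expressed as a subspace of 'cV_m. *)
Definition colspace (K : fieldType) (m n : nat) (A : 'M[K]_(m, n)) :
  {vspace 'cV[K]_m} := <<cols A>>%VS.

(* Main.v *)
Require Import Defs.
From mathcomp Require Import all_boot all_order all_algebra.
From mathcomp Require Import spectral sesquilinear reals complex.
Local Open Scope ring_scope.
Local Open Scope complex_scope.
Local Open Scope sesquilinear_scope.

(** Since the columns of [F] span the column space of [A], every column of [A]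
    is a combination of columns of [F], so [A = F *m B] for some [B]
    ([colspace_sub_factor]).  A left inverse of [F] then turns into a projector
    fixing [A]: with [Y ^t* *m F = 1] one gets
    [F *m Y ^t* *m A = F *m (Y ^t* *m F) *m B = A].
    Dually, [A ^t* = H *m C] gives [A = C ^t* *m H ^t*], so a right inverse [X]
    of [H ^t*] satisfies [A *m X *m H ^t* = A].  Composing the two identities
    proves the theorem. *)

(** The converse of the fact that the columns of a product [F *m B] are
    combinations of those of [F]: the coordinates of the columns of [A] along
    the columns of [F] assemble into the second factor. *)
Lemma colspace_sub_factor (K : fieldType) (m n k : nat)
    (A : 'M[K]_(m, n)) (F : 'M[K]_(m, k)) :
  (colspace A <= colspace F)%VS -> exists B, A = F *m B.
Proof.
move=> sAF.
exists (\matrix_(i < k, j < n) coord (cols F) i (col j A)).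
apply/matrixP => a j.
have colA_F : col j A \in colspace F.
  apply: (subvP sAF); apply: memv_span.
  by rewrite -[col j A](tnth_mktuple (fun j => col j A)) mem_tnth.
have := congr1 (fun v : 'cV_m => v a 0) (coord_span colA_F).
rewrite summxE !mxE => ->; apply: eq_bigr => i _.
by rewrite -tnth_nth tnth_mktuple !mxE GRing.mulrC.
Qed.

Theorem theorem4 (R : realType) (m n k : nat)
    (A : 'M[R[i]]_(m, n)) (hA : \rank A = k)
    (F : 'M[R[i]]_(m, k)) (hF : basis_of (colspace A) (cols F))
    (H : 'M[R[i]]_(n, k)) (hH : basis_of (colspace (A ^t*)) (cols H))
    (Y : 'M[R[i]]_(m, k)) (X : 'M[R[i]]_(n, k))
    (hYF : Y ^t* *m F = 1%:M) (hHX : H ^t* *m X = 1%:M) :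
  A = F *m Y ^t* *m A *m X *m H ^t*.
Proof.
have FYA : F *m Y ^t* *m A = A.
  have [B ->] : exists B, A = F *m B.
    by apply: colspace_sub_factor; rewrite /colspace (span_basis hF).
  by rewrite mulmxA -(mulmxA F) hYF mulmx1.
have AXH : A *m X *m H ^t* = A.
  have [C eqAC] : exists C, A ^t* = H *m C.
    by apply: colspace_sub_factor; rewrite /colspace (span_basis hH).
  have -> : A = C ^t* *m H ^t* by rewrite -[LHS]trmxCK eqAC trmx_mul map_mxM.
  by rewrite -(mulmxA _ _ X) hHX mulmx1.
by rewrite FYA AXH.
Qed.
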